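(* Assume the abc-conjecture. For every $\varepsilon>0$, $t\in[0,1)$ and integer $\omega_0\ge2$, over abc-triples with $\omega(abc)=\omega_0$ we have $$\limsup_{c\to\infty,\ \omega(abc)=\omega_0} q_t(a,b,c)\ \le\ (1+\varepsilon)\cdot\omega_0^{t/(1-t)} .$$
   Context: An abc-triple is a triple $(a,b,c)$ of positive integers with $a+b=c$ and $\gcd(a,b)=\gcd(b,c)=\gcd(a,c)=1$; $\omega=\omega(abc)$ is the number of distinct primes $p_1,\dots,p_{\omega}$ dividing $abc$; $\mathrm{rad}(n)$ is the product of the distinct primes dividing $n$. The standard quality is $q_s(a,b,c)=\ln c/\ln(\mathrm{rad}(abc))$. The abc-conjecture: for every real $\varepsilon>0$ there are only finitely many abc-triples with $q_s(a,b,c)>1+\varepsilon$. For $0<\kappa\le1$ let $M_\kappa(\{\ln p_i\})=\big(\tfrac1\omega\sum_{i=1}^\omega(\ln p_i)^\kappa\big)^{1/\kappa}$, and $M_0(\{\ln p_i\})=\big(\prod_{i=1}^\omega\ln p_i\big)^{1/\omega}$. For $t\in[0,1]$ define $$q_t(a,b,c)=\frac{\ln c}{\omega\cdot M_{1-t}(\{\ln p_i\}_{i=1}^{\omega})}.$$ *)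

(* Defs.v *)
From HB Require Import structures.
From mathcomp Require Import all_boot all_order all_algebra.
From mathcomp Require Import all_classical all_reals all_analysis.

Set Implicit Arguments.
Unset Strict Implicit.
Unset Printing Implicit Defensive.

Import Order.TTheory GRing.Theory Num.Theory.

Local Open Scope classical_set_scope.
Local Open Scope ring_scope.

Definition triple : Type := (nat * nat * nat)%type.

Definition tri_a (x : triple) : nat := x.1.1.
Definition tri_b (x : triple) : nat := x.1.2.
Definition tri_c (x : triple) : nat := x.2.

Definition abc_triple (x : triple) : Prop :=
  let: (a, b, c) := x in
  [/\ [/\ (0 < a)%N, (0 < b)%N & (0 < c)%N],
      (a + b)%N = c &
      [/\ gcdn a b = 1%N, gcdn b c = 1%N & gcdn a c = 1%N]].

Definition abc_prod (x : triple) : nat := (tri_a x * tri_b x * tri_c x)%N.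

Definition abc_primes (x : triple) : seq nat := primes (abc_prod x).

Definition abc_omega (x : triple) : nat := size (abc_primes x).

Definition rad (n : nat) : nat := (\prod_(p <- primes n) p)%N.

Definition standard_quality (R : realType) (x : triple) : R :=
  ln (tri_c x)%:R / ln (rad (abc_prod x))%:R.

Definition abc_conjecture (R : realType) : Prop :=
  forall eps : R, 0 < eps ->
    finite_set [set x | abc_triple x /\ 1 + eps < standard_quality R x].

(* Only used for kappa >= 0; the case kappa = 0 is the geometric mean. *)
Definition power_mean (R : realType) (kappa : R) (s : seq R) : R :=
  if kappa == 0 then (\prod_(y <- s) y) `^ (size s)%:R^-1
  else ((size s)%:R^-1 * \sum_(y <- s) y `^ kappa) `^ kappa^-1.

Definition log_primes (R : realType) (x : triple) : seq R :=
  [seq ln p%:R | p <- abc_primes x].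

Definition quality (R : realType) (t : R) (x : triple) : R :=
  ln (tri_c x)%:R / ((abc_omega x)%:R * power_mean (1 - t) (log_primes R x)).

(* The filter "c tends to infinity along the abc-triples with omega = w".
   It is improper when there are only finitely many such triples; the limit
   superior of any function along it is then -oo. *)
Definition c_infty_omega (w : nat) : set_system triple :=
  filter_from [set: nat]
    (fun N => [set x | [/\ abc_triple x, abc_omega x = w & (N <= tri_c x)%N]]).

(* Main.v *)
(** With [kappa = 1 - t], [omega * M_kappa = omega `^ (1 - kappa^-1) * (sum
    (ln p) `^ kappa) `^ kappa^-1], and the last factor dominates
    [sum (ln p) = ln (rad (abc))] because the l^kappa quasi-norm dominates the
    l^1 norm for [kappa <= 1]. Hence [q_t <= omega `^ (t / (1 - t)) * q_s] for
    every triple, and [q_s <= 1 + eps] for all but finitely many of them. *)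
Require Import Defs.
From HB Require Import structures.
From mathcomp Require Import all_boot all_order all_algebra.
From mathcomp Require Import all_classical all_reals all_analysis.

Import Order.TTheory GRing.Theory Num.Theory.

Local Open Scope classical_set_scope.
Local Open Scope ring_scope.

Lemma sum_le_sum_powR (R : realType) (s : seq R) (kappa : R) :
  0 < kappa -> kappa <= 1 -> {in s, forall y, 0 < y} ->
  \sum_(y <- s) y <= (\sum_(y <- s) y `^ kappa) `^ kappa^-1.
Proof.
move=> k0 k1 s0.
have ge0 : 0 <= \sum_(y <- s) y.
  by rewrite big_seq sumr_ge0 // => y /s0 /ltW.
(* The sum vanishes only for empty [s]; that case is split off because the rest divides by [S]. *)
have [->|Sn0] := eqVneq (\sum_(y <- s) y) 0; first exact: powR_ge0.
have S0 : 0 < \sum_(y <- s) y by rewrite lt_def Sn0.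
set S := \sum_(y <- s) y in ge0 Sn0 S0 *.
have ySle y : y \in s -> 0 < y / S <= 1.
  move=> ys; apply/andP; split; first by rewrite divr_gt0 // s0.
  rewrite ler_pdivrMr // mul1r /S (big_rem y) //=.
  rewrite lerDl big_seq sumr_ge0 // => z /mem_rem /s0; exact: ltW.
(* Each [y / S] lies in ]0, 1], so it is at most its [kappa]-th power. *)
have SkE : S `^ kappa <= \sum_(y <- s) y `^ kappa.
  (* The weights [y / S] add up to 1, so [S] to the [kappa] splits over [s] and the bound can be
     checked term by term. *)
  have -> : S `^ kappa = \sum_(y <- s) y / S * S `^ kappa.
    by rewrite -!mulr_suml -/S divff // mul1r.
  rewrite big_seq [leRHS]big_seq ler_sum // => y ys.
  have /andP[yS0 yS1] := ySle y ys.
  have {2}-> : y = y / S * S by rewrite divfK.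
  rewrite powRM ?(ltW yS0) // ler_wpM2r ?powR_ge0 //.
  by apply: ger1_powR => //; rewrite yS0.
have {1}-> : S = (S `^ kappa) `^ kappa^-1 by rewrite -powRrM divff ?gt_eqF // powRr1.
apply: ge0_ler_powR => //; rewrite ?invr_ge0 ?nnegrE ?powR_ge0 ?(ltW k0) //.
by rewrite sumr_ge0 // => y _; rewrite powR_ge0.
Qed.

(** With [n = size s], the averaging factor leaves the mean as [n] to the power [- kappa^-1]. The
    exponents of [n] are then [1], [- kappa^-1] and [kappa^-1 - 1]; they cancel, and the right side
    is exactly the quasi-norm of the previous lemma. *)
Lemma sum_le_power_mean (R : realType) (s : seq R) (kappa : R) :
  0 < kappa -> kappa <= 1 -> (0 < size s)%N -> {in s, forall y, 0 < y} ->
  \sum_(y <- s) y <=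
  (size s)%:R * power_mean kappa s * (size s)%:R `^ ((1 - kappa) / kappa).
Proof.
move=> k0 k1 ss s0; rewrite /power_mean gt_eqF //.
have n0 : 0 < (size s)%:R :> R by rewrite ltr0n.
rewrite powRM ?invr_ge0 ?(ltW n0) //; last first.
  by rewrite sumr_ge0 // => y _; rewrite powR_ge0.
have nE : (size s)%:R * (size s)%:R^-1 `^ kappa^-1 *
    (size s)%:R `^ ((1 - kappa) / kappa) = 1 :> R.
  rewrite -(powR_inv1 (ltW n0)) -powRrM mulN1r powRN.
  rewrite mulrBl mul1r divff ?gt_eqF // powRB ?(gt_eqF n0) ?implybT //.
  by rewrite powRr1 ?(ltW n0) // mulrA divfK ?divff ?gt_eqF // powR_gt0.
by rewrite mulrA mulrAC nE mul1r sum_le_sum_powR.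
Qed.

Lemma ln_natr_prod (R : realType) (s : seq nat) :
  {in s, forall p, (0 < p)%N} ->
  ln (\prod_(p <- s) p)%N%:R = \sum_(p <- s) ln p%:R :> R.
Proof.
elim: s => [|p s IH] s0; first by rewrite !big_nil ln1.
have s0' : {in s, forall p, (0 < p)%N} by move=> q qs; rewrite s0 // inE qs orbT.
have p0 : (0 < p)%N by rewrite s0 // inE eqxx.
have P0 : (0 < \prod_(q <- s) q)%N by rewrite big_seq prodn_cond_gt0.
by rewrite !big_cons natrM lnM ?posrE ?ltr0n // IH.
Qed.

Lemma log_primes_gt0 (R : realType) (x : triple) :
  {in log_primes R x, forall y, 0 < y}.
Proof.
move=> _ /mapP[p + ->]; rewrite mem_primes => /andP[/prime_gt1 p1 _].
by rewrite ln_gt0 // ltr1n.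
Qed.

Lemma sum_log_primes (R : realType) (x : triple) :
  \sum_(y <- log_primes R x) y = ln (Defs.rad (abc_prod x))%:R.
Proof.
rewrite big_map /Defs.rad ln_natr_prod // => p.
by rewrite mem_primes => /andP[/prime_gt0].
Qed.

Lemma quality_le_standard (R : realType) (t : R) (x : triple) :
  0 <= t -> t < 1 -> abc_triple x -> (0 < abc_omega x)%N ->
  quality t x <= standard_quality R x * (abc_omega x)%:R `^ (t / (1 - t)).
Proof.
move=> t0 t1 abcx w0.
have k0 : 0 < 1 - t by rewrite subr_gt0.
have k1 : 1 - t <= 1 by rewrite gerBl.
have sz : size (log_primes R x) = abc_omega x by rewrite size_map.
have := sum_le_power_mean R (log_primes R x) (1 - t) k0 k1.
rewrite sz subKr sum_log_primes => /(_ w0 (log_primes_gt0 R x)).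
rewrite /quality /standard_quality.
have L0 : 0 < ln (Defs.rad (abc_prod x))%:R :> R.
  rewrite -sum_log_primes; have := log_primes_gt0 R x.
  case: (log_primes R x) sz => [/= e|y s _ s0]; first by rewrite -e in w0.
  rewrite big_cons ltr_pwDl ?s0 ?inE ?eqxx // big_seq sumr_ge0 // => z zs.
  by rewrite ltW // s0 // inE zs orbT.
set L := ln (Defs.rad _)%:R in L0 *; set D := _ * power_mean _ _.
set W := _ `^ _ => LD.
have W0 : 0 < W by rewrite powR_gt0 // ltr0n.
(* Positivity of the denominator of [quality] is read off from [0 < L <= D * W], without unfolding
   the mean. *)
have D0 : 0 < D by rewrite -(pmulr_lgt0 _ W0) (lt_le_trans L0).
have lnc : 0 <= ln (tri_c x)%:R :> R.
  by rewrite ln_ge0 // ler1n; case: x abcx {w0 sz L L0 D LD W W0 D0} => -[a b] c [[]].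
by rewrite -mulrA ler_wpM2l // ler_pdivlMl // ler_pdivrMr // mulrC.
Qed.

Lemma finite_set_nat_bound (T : choiceType) (A : set T) (f : T -> nat) :
  finite_set A -> exists N, forall x, A x -> (f x < N)%N.
Proof.
move=> /finite_seqP[s ->]; exists (\max_(x <- s) f x).+1 => x xs.
by rewrite ltnS leq_bigmax_seq.
Qed.

Theorem theorem4p16 (R : realType) (abcR : abc_conjecture R)
  (eps t : R) (w0 : nat) (eps_gt0 : 0 < eps) (t_ge0 : 0 <= t) (t_lt1 : t < 1)
  (w0_ge2 : (2 <= w0)%N) :
  (limf_esup (fun x : nat * nat * nat => (quality t x)%:E) (c_infty_omega w0)
     <= ((1 + eps) * w0%:R `^ (t / (1 - t)))%:E)%E.
Proof.
(* [N] exceeds the [c] of each of the finitely many triples with standard quality above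
   [1 + eps]. *)
have [N NP] := finite_set_nat_bound _ _ tri_c (abcR eps eps_gt0).
set tail := [set x | [/\ abc_triple x, abc_omega x = w0 & (N <= tri_c x)%N]].
(* The limit superior is an infimum of suprema over the sets of the filter, so bounding the supremum
   over one tail is enough. *)
apply: ge_ereal_inf; exists (ereal_sup [set (quality t x)%:E | x in tail]).
  by exists tail => //; exists N.
apply: ge_ereal_sup => _ [x [abcx xw Nx] <-]; rewrite lee_fin.
have w0_gt0 : (0 < abc_omega x)%N by rewrite xw (leq_trans _ w0_ge2).
rewrite (le_trans (quality_le_standard _ _ _ t_ge0 t_lt1 abcx w0_gt0)) // xw.
(* A triple of the tail with standard quality above [1 + eps] would have [c < N]. *)
rewrite ler_wpM2r ?powR_ge0 // leNgt; apply/negP => qx.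
by have := NP x (conj abcx qx); rewrite ltnNge Nx.
Qed.
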